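(* Let $\alpha$ be a composition and let $\lambda$ be the partition obtained by sorting the parts of $\alpha$ into weakly decreasing order. Then every connected component of $\Gamma(\mathsf{plac})$ consisting of words whose Schensted tableaux have shape $\lambda$ contains a connected component of $\Gamma(\mathsf{hypo})$ consisting of words whose quasi-ribbon tableaux have shape $\alpha$.
   Context: Words are over the positive integers. Kashiwara operators $\tilde f_i$ ($i\ge1$) on a word $u$: replace each $i$ by $+$, each $i+1$ by $-$, delete other letters, then repeatedly delete factors $-+$ until the word has the form $+^{a}-^{b}$; if $a=0$, $\tilde f_i(u)$ is undefined, otherwise $\tilde f_i(u)$ changes the letter $i$ corresponding to the rightmost remaining $+$ into $i+1$. $\Gamma(\mathsf{plac})$ is the directed graph on all words with edges $u\to\tilde f_i(u)$ labelled $i$. Quasi-Kashiwara operator $f_i$: undefined if $u$ contains a (not necessarily consecutive) subsequence $(i+1)\,i$ or no letter $i$; otherwise replaces the rightmost $i$ by $i+1$. $\Gamma(\mathsf{hypo})$ is the directed graph on all words with edges $u\to f_i(u)$ labelled $i$; it is a subgraph of $\Gamma(\mathsf{plac})$. The Schensted tableau $P(u)$ of a word $u$ is the Young tableau produced by Schensted row insertion. A quasi-ribbon tableau of shape $\sigma=(\sigma_1,\dots,\sigma_r)$ is a filling with positive integers of the diagram having $\sigma_i$ cells in row $i$, leftmost cell of row $i+1$ directly below the rightmost cell of row $i$, weakly increasing along rows and strictly increasing down columns. The quasi-ribbon tableau of a word $u$ whose distinct letters are $a_1<\dots<a_k$ is the unique quasi-ribbon tableau containing $|u|_{a_j}$ copies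 of each $a_j$, in which $a_j$ and $a_{j+1}$ lie in different rows iff $u$ contains a subsequence $a_{j+1}a_j$. *)

(* Defs.v *)
From mathcomp Require Import all_boot.
From Stdlib Require Import Relation_Operators.
Set Implicit Arguments. Unset Strict Implicit. Unset Printing Implicit Defensive.

Definition is_word (u : seq nat) : bool := all (fun x => 0 < x) u.

Definition is_composition (a : seq nat) : bool := all (fun k => 0 < k) a.

(* Scan left to right: letter i+1 is '-', letter i is '+'.  A '-' cancels a
   later '+' (deletion of factors "-+"); the unmatched '+' are those met when
   no '-' is pending.  Returns the position of the rightmost unmatched '+'. *)
Fixpoint kash_aux (i : nat) (w : seq nat) (pos m : nat) (last : option nat)
  : option nat :=
  match w with
  | [::] => last
  | x :: w' =>
      if x == i then
        (if m is m'.+1 then kash_aux i w' pos.+1 m' last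
         else kash_aux i w' pos.+1 0 (Some pos))
      else if x == i.+1 then kash_aux i w' pos.+1 m.+1 last
      else kash_aux i w' pos.+1 m last
  end.

Definition kash_f (i : nat) (u : seq nat) : option (seq nat) :=
  match kash_aux i u 0 0 None with
  | Some p => Some (set_nth 0 u p i.+1)
  | None => None
  end.

Definition hypo_f (i : nat) (u : seq nat) : option (seq nat) :=
  if (i \in u) && ~~ subseq [:: i.+1; i] u then
    Some (set_nth 0 u ((size u).-1 - index i (rev u)) i.+1)
  else None.

Definition plac_edge (u v : seq nat) : Prop := exists i, 0 < i /\ kash_f i u = Some v.
Definition hypo_edge (u v : seq nat) : Prop := exists i, 0 < i /\ hypo_f i u = Some v.

Definition plac_conn : seq nat -> seq nat -> Prop := clos_refl_sym_trans _ plac_edge.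
Definition hypo_conn : seq nat -> seq nat -> Prop := clos_refl_sym_trans _ hypo_edge.

Definition insert_row (r : seq nat) (x : nat) : option nat * seq nat :=
  if has (fun y => x < y) r then
    let j := find (fun y => x < y) r in (Some (nth 0 r j), set_nth 0 r j x)
  else (None, rcons r x).

Fixpoint ins_tab (t : seq (seq nat)) (x : nat) : seq (seq nat) :=
  match t with
  | [::] => [:: [:: x]]
  | r :: t' =>
      match insert_row r x with
      | (None, r') => r' :: t'
      | (Some y, r') => r' :: ins_tab t' y
      end
  end.

Definition schensted_P (u : seq nat) : seq (seq nat) := foldl ins_tab [::] u.
Definition tab_shape (t : seq (seq nat)) : seq nat := map size t.

(* rows of the quasi-ribbon tableau: the distinct letters a_1 < ... < a_k are
   processed in order; a_{j+1} starts a new row iff u contains the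
   subsequence a_{j+1} a_j; each a_j contributes |u|_{a_j} cells. *)
Fixpoint qr_aux (u : seq nat) (prev : nat) (l : seq nat) (cur : seq nat)
  : seq (seq nat) :=
  match l with
  | [::] => [:: cur]
  | a :: l' =>
      if subseq [:: a; prev] u then cur :: qr_aux u a l' (nseq (count_mem a u) a)
      else qr_aux u a l' (cur ++ nseq (count_mem a u) a)
  end.

Definition qr_tableau (u : seq nat) : seq (seq nat) :=
  match sort leq (undup u) with
  | [::] => [::]
  | a :: l => qr_aux u a l (nseq (count_mem a u) a)
  end.

Definition qr_shape (u : seq nat) : seq nat := tab_shape (qr_tableau u).

(* Main.v *)
(* Every word u is Knuth equivalent to the row reading word and to the column
   reading word of P(u), i.e. to a product of weakly increasing words whose
   lengths are the parts of lambda and to a product of strictly decreasing words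
   whose lengths are the parts of the conjugate of lambda.  Kashiwara arrows
   commute with Knuth replace_letter and preserve both kinds of products, so these two
   properties hold on the whole component of u.  The row product forces a highest
   weight word to have a weight dominating lambda, the column product bounds the
   weight by lambda, so the highest weight is lambda; reversing i-strings then
   gives a word v of weight alpha.  If some i+1 never preceded an i in v, raising
   all letters i+1 to i would produce a word with one distinct letter too few for
   the first column.  So each i+1 starts a new row and the quasi-ribbon shape of
   v is alpha.  Finally quasi-Kashiwara arrows are Kashiwara arrows that do not
   change the standardisation, which determines the quasi-ribbon shape. *)

Require Import Defs.
From mathcomp Require Import all_boot.
From mathcomp Require Import zify.
From Stdlib Require Import Relation_Operators.
Set Implicit Arguments. Unset Strict Implicit. Unset Printing Implicit Defensive.

(** * Signatures and Kashiwara arrows *)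

(* The i-signature of [w] reduces to +^(plus i w) -^(minus i w). *)
Fixpoint plus (i : nat) (w : seq nat) : nat :=
  if w is x :: w' then
    if x == i then (plus i w').+1
    else if x == i.+1 then (plus i w').-1 else plus i w'
  else 0.

Fixpoint minus (i : nat) (w : seq nat) : nat :=
  if w is x :: w' then
    if x == i.+1 then minus i w' + (1 - plus i w') else minus i w'
  else 0.

(** The unmatched - of [u] cancel against the unmatched + of [v]; truncated subtraction counts the
    survivors. *)
Lemma plus_cat i u v : plus i (u ++ v) = plus i u + (plus i v - minus i u).
Proof.
elim: u => [|x u IH] /=; first lia.
case: (x =P i) => [->|_]; case: eqP => h; rewrite ?IH; lia.
Qed.

Lemma minus_cat i u v : minus i (u ++ v) = minus i v + (minus i u - plus i v).
Proof.
elim: u => [|x u IH] /=; first lia.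
case: eqP => h; rewrite IH ?plus_cat; lia.
Qed.

(** Each cancellation removes one i and one i+1. *)
Lemma count_plus_minus (i : nat) (w : seq nat) :
  count_mem i w + minus i w = count_mem i.+1 w + plus i w.
Proof.
elim: w => [|x w IH] //=; move: IH => /= IH.
by case: (x =P i) => [->|h]; case: eqP => h'; lia.
Qed.

Lemma plus_notin i w : i \notin w -> plus i w = 0.
Proof.
elim: w => [|x w IH] //=; rewrite inE negb_or eq_sym => /andP[/negPf -> /IH ->].
by case: ifP.
Qed.

Lemma minus_notin i w : i.+1 \notin w -> minus i w = 0.
Proof.
by elim: w => [|x w IH] //=; rewrite inE negb_or eq_sym => /andP[/negPf -> /IH ->].
Qed.

(** The letters [c] and [d] are kept general because an arrow and its inverse have the same
    conditions on [p] and [q], so both directions share their proofs. *)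
Definition replace_letter i c d (u v : seq nat) : Prop :=
  exists p q, [/\ u = p ++ c :: q, v = p ++ d :: q, minus i p = 0 & plus i q = 0].

(* The replaced letter is both the rightmost unmatched + of [u] and the leftmost
   unmatched - of [v], so this describes the Kashiwara operator and its inverse. *)
Definition arrow (i : nat) : seq nat -> seq nat -> Prop := replace_letter i i i.+1.

Lemma arrow_of_plus i u : 0 < plus i u -> exists v, arrow i u v.
Proof.
suff H : 0 < plus i u -> exists p q, [/\ u = p ++ i :: q, minus i p = 0 & plus i q = 0].
  by move=> /H [p [q [-> h1 h2]]]; exists (p ++ i.+1 :: q), p, q.
elim: u => [|x u IH] //= Hx.
case: (posnP (plus i u)) => [H0|/IH [p [q [Eu Hp Hq]]]].
  have -> : x = i by move: Hx; rewrite H0; case: eqP => //; case: ifP.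
  by exists [::], u.
exists (x :: p), q; split=> //=; first by rewrite Eu.
(* If x = i+1, it cancels one + and yet some + survives, so [p] contains an unmatched + that absorbs
   x. *)
move: Hx; rewrite Eu plus_cat /= eqxx; case: (x =P i.+1) => // ->; case: eqP; lia.
Qed.

Lemma arrow_of_minus i v : 0 < minus i v -> exists u, arrow i u v.
Proof.
suff H : 0 < minus i v -> exists p q, [/\ v = p ++ i.+1 :: q, minus i p = 0 & plus i q = 0].
  by move=> /H [p [q [-> h1 h2]]]; exists (p ++ i :: q), p, q.
elim: v => [|x u IH] //= Hx.
case: (posnP (minus i u)) => [H0|/IH [p [q [Eu Hp Hq]]]].
  exists [::], u; move: Hx; rewrite H0; case: eqP => // ->; split=> //; lia.
(* A leading i+1 is itself the leftmost unmatched - when no + of [p] cancels it. *)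
have [/andP[/eqP Ex /eqP p0]|Hx'] := boolP ((x == i.+1) && (plus i p == 0)).
  exists [::], u; split=> //; first by rewrite Ex.
  rewrite Eu plus_cat /= (_ : (i.+1 == i) = false) ?eqxx; lia.
exists (x :: p), q; split=> //=; first by rewrite Eu.
by case: eqP Hx' => //= _; lia.
Qed.

Lemma arrow_plus_minus i u v : arrow i u v ->
  plus i u = (plus i v).+1 /\ minus i v = (minus i u).+1.
Proof.
move=> [p [q [-> -> Hp Hq]]]; rewrite !plus_cat !minus_cat /= eqxx.
have -> : (i == i.+1) = false by lia.
have -> : (i.+1 == i) = false by lia.
rewrite eqxx; lia.
Qed.

Lemma arrow_count i u v : arrow i u v ->
  [/\ (count_mem i v).+1 = count_mem i u,
      count_mem i.+1 v = (count_mem i.+1 u).+1 &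
      forall j, j != i -> j != i.+1 -> count_mem j v = count_mem j u].
Proof.
move=> [p [q [-> -> Hp Hq]]]; split; rewrite ?count_cat /=; try lia.
by move=> j h1 h2; rewrite !count_cat /=; lia.
Qed.

Lemma arrow_word i u v : 0 < i -> arrow i u v -> is_word u = is_word v.
Proof.
by move=> i0 [p [q [-> -> _ _]]]; rewrite /is_word !all_cat /= i0.
Qed.

(** Termination measure for the climb to a highest weight word. *)
Lemma arrow_sumn i u v : arrow i u v -> sumn u < sumn v.
Proof. by move=> [p [q [-> -> _ _]]]; rewrite !sumn_cat /=; lia. Qed.

(** The [m] pending letters i+1 absorb every remaining +, so the recorded position is final. *)
Lemma kash_aux_plus0 i w pos m last :
  plus i w <= m -> kash_aux i w pos m last = last.
Proof.
elim: w pos m last => [|x w IH] pos m last //=.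
case: eqP => _; first by case: m => // m h; apply: IH.
by case: eqP => _ h; apply: IH; lia.
Qed.

Lemma kash_aux_cat i p q pos m last :
  minus i p + (m - plus i p) = 0 -> plus i q = 0 ->
  kash_aux i (p ++ i :: q) pos m last = Some (pos + size p).
Proof.
elim: p pos m last => [|x p IH] pos m last /= Hm Hq.
  rewrite (_ : m = 0); last lia.
  by rewrite eqxx kash_aux_plus0 ?Hq // addn0.
move: Hm; case: (x =P i) => [->|_].
  rewrite (_ : (i == i.+1) = false); last lia.
  by case: m => [|m] h; rewrite IH ?addSnnS //; lia.
by case: eqP => _ h; rewrite IH ?addSnnS //; lia.
Qed.

Lemma set_nth_cat (p q : seq nat) x y :
  set_nth 0 (p ++ x :: q) (size p) y = p ++ y :: q.
Proof. by elim: p => //= a p ->. Qed.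

Lemma arrow_kash i u v : arrow i u v -> kash_f i u = Some v.
Proof.
move=> [p [q [-> -> Hp Hq]]].
by rewrite /kash_f kash_aux_cat ?Hp //= set_nth_cat.
Qed.

(** * Knuth equivalence and its compatibility with arrows *)

(** Each relation is listed with its converse, so [knuth] is symmetric without a symmetry rule and
    inductions have fewer cases. *)
Inductive kn : seq nat -> seq nat -> Prop :=
| Kn1 x y z : x < y -> y <= z -> kn [:: y; z; x] [:: y; x; z]
| Kn1_sym x y z : x < y -> y <= z -> kn [:: y; x; z] [:: y; z; x]
| Kn2 x y z : x <= y -> y < z -> kn [:: x; z; y] [:: z; x; y]
| Kn2_sym x y z : x <= y -> y < z -> kn [:: z; x; y] [:: x; z; y].

Inductive knuth : seq nat -> seq nat -> Prop :=
| knuth_refl u : knuth u u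
| knuth_trans v u w : knuth u v -> knuth v w -> knuth u w
| knuth_kn p q s t : kn s t -> knuth (p ++ s ++ q) (p ++ t ++ q).

Lemma knuth_catl p u v : knuth u v -> knuth (p ++ u) (p ++ v).
Proof.
elim=> [u'|a b c _ h1 _ h2|p' q s t h]; first exact: knuth_refl.
  exact: knuth_trans h1 h2.
by rewrite !(catA p); apply: knuth_kn.
Qed.

Lemma knuth_catr p u v : knuth u v -> knuth (u ++ p) (v ++ p).
Proof.
elim=> [u'|a b c _ h1 _ h2|p' q s t h]; first exact: knuth_refl.
  exact: knuth_trans h1 h2.
by rewrite -!catA; apply: knuth_kn.
Qed.

Lemma knuth_perm u v : knuth u v -> perm_eq u v.
Proof.
elim=> [u'|a b c _ h1 _ h2|p q s t h] //; first exact: perm_trans h1 h2.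
rewrite perm_cat2l perm_cat2r; case: h => x y z _ _; apply/permP => P /=; lia.
Qed.

Lemma kn_plus_minus i s t : kn s t -> plus i s = plus i t /\ minus i s = minus i t.
Proof. 
by case=> x y z h1 h2 /=; split; repeat case: eqP => ? /=; lia.
Qed.

Lemma knuth_minus i u v : knuth u v -> minus i u = minus i v.
Proof.
elim=> [u'|a b c _ -> _ ->|p q s t /(kn_plus_minus i) [h1 h2]] //.
by rewrite !minus_cat !plus_cat h1 h2.
Qed.


(** The changed letter has three possible places in a word of three letters; [+] backtracks over
    them until all side conditions hold. *)
Ltac kn_witness :=
  lazymatch goal with
  | |- ex (fun p' => ex (fun q' => and4 ([:: ?a; ?b; ?c] = _) _ _ _)) =>
    (exists [::], [:: b; c] + exists [:: a], [:: c] + exists [:: a; b], [::]);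
    split; [ reflexivity
           | rewrite /=; repeat case: eqP => ? /=; lia
           | rewrite /=; repeat case: eqP => ? /=; lia
           | solve [ apply: Kn1; lia | apply: Kn1_sym; lia
                   | apply: Kn2; lia | apply: Kn2_sym; lia ] ]
  end.

Ltac kn_cases h1 h2 :=
  move: {+}h1 {+}h2;
  repeat match goal with H : _ = 0 |- _ => move: H end => /=;
  repeat case: eqP => ? /=; subst; try lia; move=> *;
  once kn_witness.

(** The relation may change kind: i (i+1) i and (i+1) i i are related by [Kn2], while their images
    (i+1) (i+1) i and (i+1) i (i+1) are related by [Kn1]. *)
Lemma kn_arrow (i : nat) s t p q : kn s t ->
  s = p ++ i :: q -> minus i p = 0 -> plus i q = 0 ->
  exists p' q', [/\ t = p' ++ i :: q', minus i p' = 0, plus i q' = 0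
    & kn (p ++ i.+1 :: q) (p' ++ i.+1 :: q')].
Proof.
by case=> x y z h1 h2; case: p => [|a [|b [|c [|d p]]]] //= [] *; subst => //;
  kn_cases h1 h2.
Qed.

Lemma kn_arrow_rev (i : nat) s t p q : kn s t ->
  s = p ++ i.+1 :: q -> minus i p = 0 -> plus i q = 0 ->
  exists p' q', [/\ t = p' ++ i.+1 :: q', minus i p' = 0, plus i q' = 0
    & kn (p ++ i :: q) (p' ++ i :: q')].
Proof.
by case=> x y z h1 h2; case: p => [|a [|b [|c [|d p]]]] //= [] *; subst => //;
  kn_cases h1 h2.
Qed.

Lemma cat_eq_cons (u1 u2 p q : seq nat) c : u1 ++ u2 = p ++ c :: q ->
  (exists q1, u1 = p ++ c :: q1 /\ q = q1 ++ u2) \/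
  (exists p2, p = u1 ++ p2 /\ u2 = p2 ++ c :: q).
Proof.
elim: u1 p => [|x u1 IH] [|y p] //=.
- by move=> ->; right; exists [::].
- by move=> ->; right; exists (y :: p).
- by case=> -> <-; left; exists u1.
case=> -> /IH [[q1 [-> ->]]|[p2 [-> ->]]]; first by left; exists q1.
by right; exists p2.
Qed.

(** The replaced letter lies left of, right of or inside the rewritten factor. Outside, only the
    signature of the factor matters, and [s] and [t] share it; inside, the local hypothesis
    applies. *)
Lemma knuth_replace_letter i c d :
  (forall s t p q, kn s t -> s = p ++ c :: q -> minus i p = 0 -> plus i q = 0 ->
   exists p' q', [/\ t = p' ++ c :: q', minus i p' = 0, plus i q' = 0
     & kn (p ++ d :: q) (p' ++ d :: q')]) ->
  c = i \/ c = i.+1 ->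
  forall u u' v, knuth u u' -> replace_letter i c d u v ->
  exists2 v', replace_letter i c d u' v' & knuth v v'.
Proof.
move=> H Hc u u' v Huu'; elim: Huu' v => {u u'} [u v|u' u u'' _ IH1 _ IH2 v|P Q s t Hst v].
- by move=> Hv; exists v => //; apply: knuth_refl.
- move=> /IH1 [v1 /IH2 [v2 h2 k2] k1]; exists v2 => //; exact: knuth_trans k1 k2.
have [hp hm] := kn_plus_minus i Hst.
move=> [p [q [E -> mp pq]]]; case/cat_eq_cons: E => [[q1 [EP Eq]]|[p2 [Ep /cat_eq_cons E]]].
  exists ((p ++ d :: q1) ++ t ++ Q).
    exists p, (q1 ++ t ++ Q); split; rewrite ?EP -?catA //.
    by move: pq; rewrite Eq !plus_cat hp hm.
  by rewrite Eq -cat_cons catA; apply: knuth_kn.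
case: E => [[q2 [Es Eq]]|[p3 [Ep2 EQ]]]; last first.
  exists (P ++ t ++ p3 ++ d :: q).
    exists (P ++ t ++ p3), q; split; rewrite ?EQ -?catA //.
    by move: mp; rewrite Ep Ep2 !minus_cat !plus_cat hp hm.
  by rewrite Ep Ep2 -!catA; apply: knuth_kn.
move: mp pq; rewrite Ep Eq minus_cat plus_cat => mp pq.
have m2 : minus i p2 = 0 by lia.
have p2' : plus i q2 = 0 by lia.
have [p' [q' [Et mp' pq' K]]] := H _ _ _ _ Hst Es m2 p2'.
(* These two equalities carry the side conditions through the contexts [P] and [Q]. *)
have Ep' : plus i p' = plus i p2.
  move: hp; rewrite Es Et !plus_cat; case: Hc => -> /=; case: eqP; rewrite ?eqxx; lia.
have Em' : minus i q' = minus i q2.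
  move: hm; rewrite Es Et !minus_cat; case: Hc => -> /=; case: eqP; rewrite ?eqxx; lia.
exists (P ++ (p' ++ d :: q') ++ Q); last first.
  have -> : (P ++ p2) ++ d :: q2 ++ Q = P ++ (p2 ++ d :: q2) ++ Q by rewrite -!catA.
  exact: knuth_kn.
exists (P ++ p'), (q' ++ Q); split; rewrite ?Et -?catA //.
  by rewrite minus_cat mp' Ep'; lia.
by rewrite plus_cat pq' Em'; lia.
Qed.

Lemma knuth_arrow i u u' v : knuth u u' -> arrow i u v ->
  exists2 v', arrow i u' v' & knuth v v'.
Proof. by apply: knuth_replace_letter; [apply: kn_arrow | left]. Qed.

Lemma knuth_arrow_rev i u u' v : knuth u u' -> arrow i v u ->
  exists2 v', arrow i v' u' & knuth v v'.
Proof.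
move=> K [p [q [Ev Eu Hp Hq]]].
have [||v' [p' [q' [? ? ? ?]]] K'] :=
  @knuth_replace_letter i i.+1 i (@kn_arrow_rev i) _ _ _ v K.
- by right.
- by exists p, q.
by exists v' => //; exists p', q'.
Qed.

(** * Products of rows and products of columns along arrows *)

Definition blocks (Q : pred (seq nat)) (sh : seq nat) (v : seq nat) : Prop :=
  exists B, [/\ all Q B, map size B = sh & knuth v (flatten B)].

(** The replaced letter lies in a single factor, and the pieces of that factor around it inherit the
    vanishing of [minus] and [plus]. *)
Lemma flatten_replace_letter i c d (Q : pred (seq nat)) :
  (forall p q, Q (p ++ c :: q) -> minus i p = 0 -> plus i q = 0 -> Q (p ++ d :: q)) ->
  forall B v, all Q B -> replace_letter i c d (flatten B) v ->
  exists B', [/\ all Q B', map size B' = map size B & v = flatten B'].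
Proof.
move=> H; elim=> [|b B IH] v /=; first by move=> _ [[|? p] [q []]].
move=> /andP[Qb QB] [p [q [E -> mp pq]]].
case/cat_eq_cons: E => [[q1 [Eb Eq]]|[p2 [Ep EB]]].
  exists ((p ++ d :: q1) :: B); split; rewrite /= ?Eb ?Eq ?size_cat -?catA //.
  rewrite QB andbT; apply: H; rewrite -?Eb //.
  by move: pq; rewrite Eq plus_cat; lia.
have [|B' [QB' <- E]] := IH (p2 ++ d :: q) QB.
  exists p2, q; split=> //; by move: mp; rewrite Ep minus_cat; lia.
by exists (b :: B'); split; rewrite /= ?Qb // Ep -E catA.
Qed.

(** In a weakly increasing word each i precedes each i+1, so every i stays unmatched. *)
Lemma sorted_leq_plus0 i q : sorted leq q -> plus i q = 0 -> i \notin q.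
Proof.
elim: q => [|x q IH] //= Hx; have Hq := path_sorted Hx.
case: (x =P i) => // nx; rewrite inE negb_or; case: (x =P i.+1) => [Ex _|_ /(IH Hq) ->].
  rewrite Ex; apply/andP; split; first lia.
  by apply/negP => iq; move: (allP (order_path_min leq_trans Hx) _ iq); lia.
by rewrite andbT; apply/eqP => h; apply: nx.
Qed.

Lemma sorted_leq_minus0 i p : sorted leq p -> minus i p = 0 -> i.+1 \notin p.
Proof.
elim: p => [|x p IH] //= Hx; have Hp := path_sorted Hx.
case: (x =P i.+1) => [Ex|nx].
  rewrite plus_notin; first lia.
  by apply/negP => ip; move: (allP (order_path_min leq_trans Hx) _ ip); lia.
by move=> /(IH Hp) Hn; rewrite inE negb_or Hn andbT; apply/eqP => h; apply: nx.
Qed.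

Lemma gtn_trans : transitive gtn.
Proof. by move=> x y z /= h1 h2; apply: ltn_trans h2 h1. Qed.

Lemma sorted_cat_consE (e : rel nat) p x q : transitive e ->
  sorted e (p ++ x :: q) =
  [&& sorted e p, sorted e q, all (e^~ x) p, all (e x) q & allrel e p q].
Proof.
move=> et; rewrite !sorted_pairwise // pairwise_cat pairwise_cons allrel_consr.
by case: (pairwise e p); case: (pairwise e q); case: (all _ p); case: (all _ q);
   case: allrel.
Qed.

Lemma row_arrow i p q : sorted leq (p ++ i :: q) ->
  minus i p = 0 -> plus i q = 0 -> sorted leq (p ++ i.+1 :: q).
Proof.
rewrite !(sorted_cat_consE _ _ _ leq_trans).
move=> /and5P[Hp Hq /allP pi /allP qi pq] mp pl; rewrite Hp Hq pq !andbT /=.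
apply/andP; split; apply/allP => y Hy; first by move: (pi y Hy) => /=; lia.
have iq := sorted_leq_plus0 Hq pl; have := qi y Hy.
by rewrite leq_eqVlt => /orP[/eqP E|//]; rewrite E Hy in iq.
Qed.

Lemma row_arrow_rev i p q : sorted leq (p ++ i.+1 :: q) ->
  minus i p = 0 -> plus i q = 0 -> sorted leq (p ++ i :: q).
Proof.
rewrite !(sorted_cat_consE _ _ _ leq_trans).
move=> /and5P[Hp Hq /allP pi /allP qi pq] mp pl; rewrite Hp Hq pq !andbT /=.
apply/andP; split; apply/allP => y Hy; last by move: (qi y Hy) => /=; lia.
have iq := sorted_leq_minus0 Hp mp; have := pi y Hy.
by rewrite /= leq_eqVlt => /orP[/eqP E|//]; rewrite -E Hy in iq.
Qed.

(** All letters of [p] exceed i, so nothing in [p] could cancel an i+1, and [minus i p = 0] excludes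
    i+1 from [p]. *)
Lemma column_arrow i p q : sorted gtn (p ++ i :: q) ->
  minus i p = 0 -> plus i q = 0 -> sorted gtn (p ++ i.+1 :: q).
Proof.
rewrite !(sorted_cat_consE _ _ _ gtn_trans).
move=> /and5P[Hp Hq /allP pi /allP qi pq] mp pl; rewrite Hp Hq pq !andbT /=.
apply/andP; split; apply/allP => y Hy; last by move: (qi y Hy) => /=; lia.
have ip : i \notin p by apply/negP => h; move: (pi _ h) => /=; lia.
have /eqP := count_plus_minus i p.
rewrite mp (plus_notin ip) !addn0 (count_memPn ip) eq_sym -leqn0 leqNgt -has_count has_pred1 => h.
have := pi y Hy => /=; rewrite leq_eqVlt => /orP[/eqP E|//].
by rewrite E Hy in h.
Qed.

Lemma column_arrow_rev i p q : sorted gtn (p ++ i.+1 :: q) ->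
  minus i p = 0 -> plus i q = 0 -> sorted gtn (p ++ i :: q).
Proof.
rewrite !(sorted_cat_consE _ _ _ gtn_trans).
move=> /and5P[Hp Hq /allP pi /allP qi pq] mp pl; rewrite Hp Hq pq !andbT /=.
apply/andP; split; apply/allP => y Hy; first by move: (pi y Hy) => /=; lia.
have iq : i.+1 \notin q by apply/negP => h; move: (qi _ h) => /=; lia.
have /eqP := count_plus_minus i q.
rewrite pl (minus_notin iq) !addn0 (count_memPn iq) -leqn0 leqNgt -has_count has_pred1 => h.
have := qi y Hy => /=; rewrite ltnS leq_eqVlt => /orP[/eqP E|//].
by rewrite -E Hy in h.
Qed.

Lemma blocks_arrow i (Q : pred (seq nat)) sh u v :
  (forall p q, Q (p ++ i :: q) -> minus i p = 0 -> plus i q = 0 -> Q (p ++ i.+1 :: q)) ->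
  blocks Q sh u -> arrow i u v -> blocks Q sh v.
Proof.
move=> H [B [QB <- K]] /(knuth_arrow K) [v' a' K'].
have [B' [QB' sB' E]] := flatten_replace_letter H QB a'.
by exists B'; split; rewrite // -E.
Qed.

Lemma blocks_arrow_rev i (Q : pred (seq nat)) sh u v :
  (forall p q, Q (p ++ i.+1 :: q) -> minus i p = 0 -> plus i q = 0 -> Q (p ++ i :: q)) ->
  blocks Q sh v -> arrow i u v -> blocks Q sh u.
Proof.
move=> H [B [QB <- K]] /(knuth_arrow_rev K) [u' [p [q [Eu' EB mp pq]]] K'].
have [|B' [QB' sB' E]] := flatten_replace_letter H QB (v := u'); first by exists p, q.
by exists B'; split; rewrite // -E.
Qed.

(** * Schensted insertion and the row reading word *)

Lemma knuth_cons x u v : knuth u v -> knuth (x :: u) (x :: v).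
Proof. exact: (@knuth_catl [:: x]). Qed.

Lemma knuth_eq u v : u = v -> knuth u v.
Proof. by move=> ->; apply: knuth_refl. Qed.

Lemma knuth_slide y r x : sorted leq (y :: r) -> x < y ->
  knuth (y :: rcons r x) [:: y, x & r].
Proof.
elim: r y => [|z r IH] y /=; first by move=> _ _; apply: knuth_refl.
move=> /andP[yz Hr] xy; apply: (@knuth_trans [:: y, z, x & r]).
  by apply: knuth_cons; apply: IH => //; apply: leq_trans xy yz.
by apply: (@knuth_kn [::] r [:: y; z; x] [:: y; x; z]); constructor.
Qed.

(* Bumping: [knuth_slide] carries the inserted letter [x] left to the bumped
   letter [y], and [knuth_bump] carries [y] out in front of the row. *)
Lemma knuth_bump r x y : sorted leq (rcons r x) -> x < y ->
  knuth (r ++ [:: y; x]) (y :: rcons r x).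
Proof.
elim: r => [|a r IH] /=; first by move=> _ _; apply: knuth_refl.
move=> Hr xy; have Hr' := path_sorted Hr.
apply: (@knuth_trans [:: a, y & rcons r x]); first by apply: knuth_cons; apply: IH.
have rx b : b \in rcons r x -> b <= x.
  move: Hr'; rewrite -cats1 (sorted_cat_consE _ _ _ leq_trans).
  move=> /and5P[_ _ /allP h _ _]; rewrite mem_cat inE => /orP[/h //|/eqP -> //].
case: (rcons r x) Hr rx (size_rcons r x) => [|b s] //= /andP[ab _] rx _.
apply: (@knuth_kn [::] s [:: a; y; b] [:: y; a; b]); constructor => //.
by apply: leq_ltn_trans xy; apply: rx; rewrite inE eqxx.
Qed.

Lemma insert_row_cons b s x : insert_row (b :: s) x =
  if x < b then (Some b, x :: s)
  else ((insert_row s x).1, b :: (insert_row s x).2).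
Proof. by rewrite /insert_row /=; case: ltnP => //= _; case: ifP. Qed.

Variant insert_row_spec r x : option nat * seq nat -> Type :=
| InsertEnd of all (fun y => y <= x) r : insert_row_spec r x (None, rcons r x)
| InsertBump r1 y r2 of r = r1 ++ y :: r2 & x < y & all (fun y => y <= x) r1 :
    insert_row_spec r x (Some y, r1 ++ x :: r2).

Lemma insert_rowP r x : insert_row_spec r x (insert_row r x).
Proof.
elim: r => [|b r IH]; first exact: InsertEnd.
rewrite insert_row_cons; case: ltnP => [xb|bx].
  exact: (@InsertBump _ _ [::] b r).
case: IH => [H|r1 y r2 -> xy H]; first by apply: InsertEnd; rewrite /= bx.
by apply: (@InsertBump _ _ (b :: r1) y r2); rewrite //= bx.
Qed.

Lemma insert_row_sorted r x : sorted leq r -> sorted leq (insert_row r x).2.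
Proof.
case: insert_rowP => [H|r1 y r2 -> xy H] /=.
  rewrite -cats1 (sorted_cat_consE _ _ _ leq_trans).
  by move=> ->; rewrite H /= allrel0r.
rewrite !(sorted_cat_consE _ _ _ leq_trans).
move=> /and5P[-> -> _ /allP h ->]; rewrite H andbT /=.
by apply/allP => z /h /= yz; lia.
Qed.

(* The row [s] may stand below the row [r] in a tableau. *)
Fixpoint dom (r s : seq nat) {struct s} : bool :=
  match s, r with
  | [::], _ => true
  | y :: s', x :: r' => (x < y) && dom r' s'
  | _ :: _, [::] => false
  end.

Lemma dom_rcons r s x : dom r s -> dom (rcons r x) s.
Proof. by elim: r s => [|a r IH] [|b s] //= /andP[-> /IH]. Qed.

Lemma dom_lower r1 r2 s x y : x <= y -> dom (r1 ++ y :: r2) s -> dom (r1 ++ x :: r2) s.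
Proof.
move=> xy; elim: r1 s => [|a r1 IH] [|b s] //= /andP[h1 h2].
  by rewrite h2 andbT; apply: leq_ltn_trans h1.
by rewrite h1 IH.
Qed.

(** The bumped letter [y] enters the lower row weakly left of the column it came from, where the new
    upper row has only letters at most [x]. *)
Lemma dom_insert r1 r2 s x y : x < y -> all (fun z => z <= x) r1 ->
  dom (r1 ++ y :: r2) s -> dom (r1 ++ x :: r2) (insert_row s y).2.
Proof.
move=> xy; elim: r1 s => [|a r1 IH] [|b s] H D.
- by rewrite /= xy.
- by move: D; rewrite insert_row_cons /= => /andP[yb D]; rewrite yb /= xy D.
- by move: H => /= /andP[ax _]; rewrite andbT; apply: leq_ltn_trans xy.
move: D H; rewrite insert_row_cons /= => /andP[ab D] /andP[ax H].
case: ltnP => yb /=; last by rewrite ab IH.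
by rewrite (leq_ltn_trans ax xy); apply: dom_lower D; apply: ltnW.
Qed.

Definition tableau (t : seq (seq nat)) : bool := all (sorted leq) t && sorted dom t.

Lemma tableau_cons r t :
  tableau (r :: t) = [&& sorted leq r, dom r (head [::] t) & tableau t].
Proof.
rewrite /tableau /=; case: t => [|s t] /=; first by rewrite !andbT; case: r.
by case: (sorted leq r); case: dom; rewrite //= ?andbF.
Qed.

(** The new first row is recorded because the induction must compare it with the row above. *)
Lemma ins_tab_tableau t x : tableau t ->
  tableau (ins_tab t x) /\ head [::] (ins_tab t x) = (insert_row (head [::] t) x).2.
Proof.
elim: t x => [|r t IH] x; first by [].
rewrite tableau_cons => /and3P[Hr D Ht] /=.
have := insert_row_sorted x Hr.
case: insert_rowP => [H|r1 y r2 Er xy H] /= Hr'.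
  by split=> //; rewrite tableau_cons Hr' Ht dom_rcons.
have [T1 T2] := IH y Ht; split=> //; rewrite tableau_cons Hr' T1 T2 andbT /=.
by apply: dom_insert => //; rewrite -Er.
Qed.

Definition row_word (t : seq (seq nat)) : seq nat := flatten (rev t).

Lemma row_word_cons r t : row_word (r :: t) = row_word t ++ r.
Proof. by rewrite /row_word rev_cons flatten_rcons. Qed.

Lemma ins_tab_knuth t x : tableau t ->
  knuth (row_word t ++ [:: x]) (row_word (ins_tab t x)).
Proof.
elim: t x => [|r t IH] x; first by move=> _; apply: knuth_refl.
rewrite tableau_cons => /and3P[Hr D Ht] /=.
case: insert_rowP => [H|r1 y r2 Er xy H].
  by rewrite !row_word_cons -cats1 catA; apply: knuth_refl.
rewrite !row_word_cons -catA.
(* In the intermediate word, [y] has left its row and stands ready for insertion into the rows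
   below. *)
apply: (@knuth_trans (row_word t ++ [:: y] ++ r1 ++ x :: r2)); last first.
  by rewrite catA; apply: knuth_catr; apply: IH.
apply: knuth_catl; move: Hr; rewrite Er (sorted_cat_consE _ _ _ leq_trans).
move=> /and5P[S1 S2 _ A2 _].
apply: (@knuth_trans (r1 ++ [:: y, x & r2])).
  rewrite -catA; apply: knuth_catl; rewrite /= cats1; apply: knuth_slide => //.
  by rewrite /= path_sortedE ?A2 //; exact: leq_trans.
have -> : r1 ++ [:: y, x & r2] = (r1 ++ [:: y; x]) ++ r2 by rewrite -catA.
have -> : [:: y] ++ r1 ++ x :: r2 = (y :: rcons r1 x) ++ r2 by rewrite /= cat_rcons.
apply: knuth_catr; apply: knuth_bump => //.
rewrite -cats1 (sorted_cat_consE _ _ _ leq_trans).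
by rewrite S1 H /= allrel0r.
Qed.

Lemma schensted_knuth u :
  tableau (schensted_P u) /\ knuth u (row_word (schensted_P u)).
Proof.
elim/last_ind: u => [|u x [T K]]; first by split; last exact: knuth_refl.
rewrite /schensted_P foldl_rcons; split; first by case: (ins_tab_tableau x T).
rewrite -cats1; apply: knuth_trans (ins_tab_knuth x T); exact: knuth_catr.
Qed.

(** * The column reading word *)

Lemma knuth_slide_row c r d : sorted leq (c :: r) -> path gtn c d ->
  knuth ((c :: r) ++ d) (c :: d ++ r).
Proof.
elim: d c => [|x d IH] c Hr /=; first by move=> _; rewrite cats0; apply: knuth_refl.
move=> /andP[xc Hd]; apply: (@knuth_trans [:: c, x & r ++ d]).
  rewrite -cat_rcons -!cat_cons; apply: knuth_catr; exact: knuth_slide.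
apply: knuth_cons; apply: IH => //.
case: r Hr => //= a r /andP[ca ->]; rewrite andbT; apply: ltnW; exact: leq_trans ca.
Qed.

(** The accumulator [d] holds the first column entries of the rows above [t]. The row word lists
    lower rows first, so the column grows at its left end. *)
Lemma knuth_peel t d : tableau t -> sorted gtn d ->
  (if head [::] t is c :: _ then all (gtn c) d else true) ->
  knuth (row_word t ++ d) (rev (pmap ohead t) ++ d ++ row_word (map behead t)).
Proof.
elim: t d => [|r t IH] d; first by move=> *; rewrite /row_word /= cats0; apply: knuth_refl.
rewrite tableau_cons => /and3P[Hr D Ht] Hd; case: r Hr D => [|c r] Hr D /=.
  move=> _; rewrite !row_word_cons !cats0; apply: IH => //.
  by case: (head [::] t) D.
move=> cd; rewrite !row_word_cons rev_cons -cats1.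
apply: (@knuth_trans ((row_word t ++ c :: d) ++ r)).
  rewrite -!catA; apply: knuth_catl; apply: knuth_slide_row => //.
  by rewrite path_sortedE ?cd //; apply: gtn_trans.
have -> : (rev (pmap ohead t) ++ [:: c]) ++ d ++ row_word (map behead t) ++ r =
  (rev (pmap ohead t) ++ (c :: d) ++ row_word (map behead t)) ++ r by rewrite -!catA.
apply: knuth_catr; apply: IH => //=.
  by rewrite path_sortedE ?cd //; apply: gtn_trans.
case: (head [::] t) D => //= c' s /andP[cc' _]; rewrite cc' /=.
by apply: sub_all cd => z /= zc; apply: ltn_trans cc'.
Qed.

Lemma pmap_ohead_nil t : path dom [::] t -> pmap ohead t = [::].
Proof. by elim: t => [|[|c r] t IH] //= /IH. Qed.

Lemma sorted_pmap_ohead t : sorted dom t -> sorted ltn (pmap ohead t).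
Proof.
elim: t => [|[|c r] t IH] //= Ht; first by rewrite pmap_ohead_nil.
have := IH (path_sorted Ht); case: t Ht {IH} => [|[|c' s] t] //=.
  by move=> Ht _; rewrite pmap_ohead_nil.
by move=> /andP[/andP[-> _] _].
Qed.

Lemma tableau_behead t : tableau t -> tableau (map behead t).
Proof.
elim: t => [|r t IH] //; rewrite tableau_cons /= tableau_cons => /and3P[Hr D /IH ->].
rewrite andbT; apply/andP; split; first by case: r Hr {D} => //= a s /path_sorted.
case: t D {IH} => [|s t] //=.
by case: r {Hr} s => [|a r] [|b s] //= /andP[].
Qed.

(** [pmap ohead t] is the first column; nonempty rows come first, so [minn k] of its length counts
    its cells in the first k rows. *)
Lemma sumn_take_peel t k : sorted dom t ->
  sumn (take k (map size t)) =
  minn k (size (pmap ohead t)) + sumn (take k (map size (map behead t))).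
Proof.
elim: t k => [|r t IH] [|k] //= Ht; rewrite ?minn0 ?min0n //=.
rewrite IH ?(path_sorted Ht) //; case: r Ht => [|c r] Ht /=.
  by rewrite pmap_ohead_nil //= !minn0.
rewrite minnSS; lia.
Qed.

Lemma sumn_size_peel (t : seq (seq nat)) :
  sumn (map size t) = size (pmap ohead t) + sumn (map size (map behead t)).
Proof. by elim: t => [|[|c r] t IH] //=; rewrite IH; lia. Qed.

Lemma pmap_ohead_nil_sumn (t : seq (seq nat)) : pmap ohead t = [::] -> sumn (map size t) = 0.
Proof. by elim: t => [|[|c r] t IH]. Qed.

(* The last clause says that the lengths of the columns form the conjugate shape,
   in the form used to bound the number of letters taken from a set of size [k]. *)
Lemma row_word_columns t : tableau t -> exists C,
  [/\ all (sorted gtn) C, knuth (row_word t) (flatten C) &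
      forall k, sumn (map (minn k) (map size C)) = sumn (take k (map size t))].
Proof.
have [n] := ubnP (sumn (map size t)); elim: n t => // n IH t Hn Ht.
case E: (pmap ohead t) => [|c l].
  have E0 := pmap_ohead_nil_sumn E; exists [::]; split=> // [|k] /=.
    apply: knuth_eq; apply/nilP; rewrite /nilp /row_word size_flatten /shape map_rev.
    by rewrite sumn_rev E0.
  by apply/esym/eqP; rewrite -leqn0 -E0 -{2}(cat_take_drop k (map size t)) sumn_cat leq_addr.
have [|C [HC K S]] := IH (map behead t) _ (tableau_behead Ht).
  by move: Hn; rewrite sumn_size_peel E /=; lia.
have Hd : sorted dom t by case/andP: Ht.
exists (rev (pmap ohead t) :: C); split=> /=.
- by rewrite HC andbT rev_sorted; apply: sorted_pmap_ohead.
- have := @knuth_peel t [::] Ht isT; rewrite cats0 => /(_ _) K'.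
  apply: knuth_trans (K' _) _; first by case: (head _ _).
  exact: knuth_catl.
by move=> k; rewrite size_rev S -sumn_take_peel.
Qed.

(** * Words reachable inside a component *)

(* [csh] lists the column lengths, [lam] the row lengths. *)
Definition component_inv (lam csh v : seq nat) : Prop :=
  [/\ is_word v, blocks (sorted leq) (rev lam) v & blocks (sorted gtn) csh v].

Definition reach (lam csh u v : seq nat) : Prop :=
  plac_conn u v /\ component_inv lam csh v.

Lemma reach_trans lam csh u v w :
  reach lam csh u v -> reach lam csh v w -> reach lam csh u w.
Proof. by move=> [c1 _] [c2 inv]; split=> //; apply: rst_trans c1 c2. Qed.

Lemma reach_arrow lam csh i u v : 0 < i -> component_inv lam csh u ->
  arrow i u v -> reach lam csh u v.
Proof.
move=> i0 [uw ur uc] a; split.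
  by apply: rst_step; exists i; split=> //; apply: arrow_kash.
split; first by rewrite -(arrow_word i0 a).
  by apply: blocks_arrow a => // *; apply: row_arrow.
by apply: blocks_arrow a => // *; apply: column_arrow.
Qed.

Lemma reach_arrow_rev lam csh i u v : 0 < i -> component_inv lam csh v ->
  arrow i u v -> reach lam csh v u.
Proof.
move=> i0 [uw ur uc] a; split.
  by apply: rst_sym; apply: rst_step; exists i; split=> //; apply: arrow_kash.
split; first by rewrite (arrow_word i0 a).
  by apply: blocks_arrow_rev a => // *; apply: row_arrow_rev.
by apply: blocks_arrow_rev a => // *; apply: column_arrow_rev.
Qed.

(** * Highest weight words and their weight *)

(** A strictly decreasing factor uses each letter of [S] at most once. *)
Lemma count_columns_le csh v (S : seq nat) : blocks (sorted gtn) csh v ->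
  count (mem S) v <= sumn (map (minn (size S)) csh).
Proof.
move=> [C [HC <- /knuth_perm /permP ->]]; rewrite count_flatten.
elim: C HC => //= c C IH /andP[Hc /IH H]; apply: leq_add => //.
rewrite leq_min count_size andbT -size_filter uniq_leq_size //.
  by apply: filter_uniq; apply: (sorted_uniq gtn_trans) Hc => x; apply: ltnn.
by move=> x; rewrite mem_filter => /andP[].
Qed.

(** The largest letter z of the first row, its last one, must be matched by some z-1 further right,
    and by induction that letter is at most the number of remaining rows. *)
Lemma yamanouchi_le R : all (sorted leq) R ->
  (forall i, 0 < i -> minus i (flatten R) = 0) ->
  all (fun x => x <= size R) (flatten R).
Proof.
elim: R => //= r R IH /andP[Hr HR] H.
have {}IH : all (fun x => x <= size R) (flatten R).
  by apply: IH => // i /H; rewrite minus_cat; lia.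
rewrite all_cat; apply/andP; split; last by apply: sub_all IH => x /leqW.
case/lastP: r Hr H => // r z; rewrite -cats1 (sorted_cat_consE _ _ _ leq_trans).
move=> /and5P[_ _ /allP rz _ _] H.
have zR : z <= (size R).+1.
  rewrite leqNgt; apply/negP => Hz; have := H z.-1; rewrite -catA minus_cat /=.
  rewrite (prednK (leq_trans (ltn0Sn _) Hz)) eqxx plus_notin; first lia.
  by apply/negP => /(allP IH); lia.
by rewrite all_cat /= zR !andbT; apply/allP => x /rz h; apply: leq_trans zR.
Qed.

(** The last k rows again have no unmatched -, so [yamanouchi_le] bounds their letters by k. *)
Lemma yamanouchi_count R k : all (sorted leq) R ->
  (forall i, 0 < i -> minus i (flatten R) = 0) ->
  sumn (drop (size R - k) (map size R)) <= count (fun x => x <= k) (flatten R).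
Proof.
elim: R => //= r R IH HR H; case: (leqP (size R).+1 k) => Hk.
  have := @yamanouchi_le (r :: R) HR H => /= Ha.
  have -> : count (fun x => x <= k) (r ++ flatten R) = size (r ++ flatten R).
    by apply/eqP; rewrite -all_count; apply: sub_all Ha => x h; apply: leq_trans Hk.
  by rewrite (_ : _ - k = 0) ?size_cat ?size_flatten //; lia.
rewrite subSn //= count_cat; apply: leq_trans (leq_addl _ _); apply: IH.
  by case/andP: HR.
by move=> i /H; rewrite minus_cat; lia.
Qed.

Lemma sumn_takeS s k : sumn (take k.+1 s) = sumn (take k s) + nth 0 s k.
Proof.
elim: s k => [|x s IH] [|k] //=; first by rewrite take0 addn0.
by rewrite -addnA -IH.
Qed.

Lemma highest_weight_content lam csh h :
  (forall k, sumn (map (minn k) csh) = sumn (take k lam)) ->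
  component_inv lam csh h -> (forall i, 0 < i -> minus i h = 0) ->
  forall j, count_mem j.+1 h = nth 0 lam j.
Proof.
move=> Hc [hw [R [HR sR KR]] hC] H0.
(* The columns give the upper bound, with [S] the set of letters from 1 to k, and the rows the lower
   bound. Differences in k then give the content. *)
have E k : count (fun x => x <= k) h = sumn (take k lam).
  apply/eqP; rewrite eqn_leq; apply/andP; split.
    rewrite -Hc -{2}(size_iota 1 k); apply: leq_trans (count_columns_le _ hC).
    rewrite leq_eqVlt; apply/orP; left; apply/eqP; apply: eq_in_count => x /(allP hw) x0 /=.
    by rewrite mem_iota; lia.
  rewrite (permP (knuth_perm KR)).
  have := @yamanouchi_count R k HR; rewrite sR drop_rev sumn_rev.
  have <- : size lam = size R by rewrite -(size_rev lam) -sR size_map.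
  have -> : sumn (take (size lam - (size lam - k)) lam) = sumn (take k lam).
    case: (leqP k (size lam)) => hk; first by rewrite subKn.
    by rewrite (_ : _ - (_ - _) = size lam) ?take_size ?take_oversize //; lia.
  by apply=> i /H0 <-; apply/esym; apply: knuth_minus.
move=> j; apply: (@addnI (sumn (take j lam))); rewrite -sumn_takeS -!E.
by elim: (h) => //= x s IH; move: IH => /=; lia.
Qed.

Lemma reach_highest lam csh u : component_inv lam csh u ->
  exists2 h, reach lam csh u h & forall i, 0 < i -> minus i h = 0.
Proof.
have [n] := ubnP (sumn u); elim: n u => // n IH u Hn Hu.
(* An unmatched i+1 must occur in [u], so the search over all i reduces to the letters of [u]. *)
have [/hasP[x _ /andP[x1 xm]]|/hasPn N] :=
  boolP (has (fun x => (1 < x) && (0 < minus x.-1 u)) u).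
  have [v a] := arrow_of_minus xm.
  have r : reach lam csh u v by apply: reach_arrow_rev a => //; lia.
  have [||h rh Hh] := IH v; first by have := arrow_sumn a; lia.
    by case: r.
  by exists h => //; apply: reach_trans rh.
exists u; first by split=> //; apply: rst_refl.
move=> i i0; case: (boolP (i.+1 \in u)) => [/N|/minus_notin] //=.
by rewrite ltnS i0 /=; lia.
Qed.

(** * Permuting the weight along i-strings *)

Lemma lower_string lam csh i k u : 0 < i -> component_inv lam csh u -> k <= plus i u ->
  exists v, [/\ reach lam csh u v, count_mem i v + k = count_mem i u,
    count_mem i.+1 v = count_mem i.+1 u + k
    & forall j, j != i -> j != i.+1 -> count_mem j v = count_mem j u].
Proof.
move=> i0; elim: k u => [|k IH] u Hu Hk.
  by exists u; rewrite !addn0; split=> //; split=> //; apply: rst_refl.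
have [|v a] := @arrow_of_plus i u; first by lia.
have r := reach_arrow i0 Hu a; have [c1 c2 c3] := arrow_count a.
have [||w [rw e1 e2 e3]] := IH v; first by case: r.
  by have [] := arrow_plus_minus a; lia.
exists w; split; [exact: reach_trans rw|lia|lia|].
by move=> j h1 h2; rewrite e3 // c3.
Qed.

Lemma raise_string lam csh i k u : 0 < i -> component_inv lam csh u -> k <= minus i u ->
  exists v, [/\ reach lam csh u v, count_mem i v = count_mem i u + k,
    count_mem i.+1 v + k = count_mem i.+1 u
    & forall j, j != i -> j != i.+1 -> count_mem j v = count_mem j u].
Proof.
move=> i0; elim: k u => [|k IH] u Hu Hk.
  by exists u; rewrite !addn0; split=> //; split=> //; apply: rst_refl.
have [|v a] := @arrow_of_minus i u; first by lia.
have r := reach_arrow_rev i0 Hu a; have [c1 c2 c3] := arrow_count a.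
have [||w [rw e1 e2 e3]] := IH v; first by case: r.
  by have [] := arrow_plus_minus a; lia.
exists w; split; [exact: reach_trans rw|lia|lia|].
by move=> j h1 h2; rewrite e3 // c3.
Qed.

(** Entry j belongs to the letter j+1, and the default 0 excludes letters beyond the length of
    [s]. *)
Definition has_content (s v : seq nat) : Prop :=
  forall j, count_mem j.+1 v = nth 0 s j.

(** This is the reflection of an i-string: x - y is the number of unmatched + minus that of
    unmatched -, so the string has enough room for the steps. *)
Lemma reach_swap lam csh u s1 x y s2 : component_inv lam csh u ->
  has_content (s1 ++ x :: y :: s2) u ->
  exists2 v, reach lam csh u v & has_content (s1 ++ y :: x :: s2) v.
Proof.
move=> Hu Hc; set i := (size s1).+1; have i0 : 0 < i by [].
have cx : count_mem i u = x by rewrite Hc nth_cat ltnn subnn.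
have cy : count_mem i.+1 u = y.
  by rewrite Hc nth_cat ltnNge leqnSn /= subSn // subnn.
have pm := count_plus_minus i u.
have [v [rv e1 e2 e3]] : exists v, [/\ reach lam csh u v, count_mem i v = y,
    count_mem i.+1 v = x
    & forall j, j != i -> j != i.+1 -> count_mem j v = count_mem j u].
  case: (leqP y x) => xy.
    have [|v [r e1 e2 e3]] := @lower_string lam csh i (x - y) u i0 Hu; first by lia.
    by exists v; split=> //; lia.
  have [|v [r e1 e2 e3]] := @raise_string lam csh i (y - x) u i0 Hu; first by lia.
  by exists v; split=> //; lia.
exists v => // j; case: (j.+1 =P i) => [E|n1].
  by rewrite E e1; case: E => ->; rewrite nth_cat ltnn subnn.
case: (j.+1 =P i.+1) => [E|n2].
  by rewrite E e2; case: E => ->; rewrite nth_cat ltnNge leqnSn /= subSn // subnn.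
rewrite e3; [|exact/eqP|exact/eqP]; rewrite Hc !nth_cat; case: ltnP => // hj.
move: n1 n2; rewrite /i; case E: (j - size s1) => [|[|d]] //=; lia.
Qed.

(** The head of [t] is moved by swaps to the front of [s]; generalising [P] lets the induction run
    on the tails behind this fixed head. *)
Lemma perm_swap_ind (P : seq nat -> Prop) :
  (forall s1 x y s2, P (s1 ++ x :: y :: s2) -> P (s1 ++ y :: x :: s2)) ->
  forall s t, perm_eq s t -> P s -> P t.
Proof.
move=> H s t; elim: t P H s => [|y t IH] P H s; first by move/perm_nilP => ->.
move=> st; have ys : y \in s by rewrite (perm_mem st) mem_head.
case/splitPr: ys st => p1 p2 st Ps.
apply: (IH (fun s => P (y :: s))) (p1 ++ p2) _ _.
- by move=> s1 a b s2; apply: (H (y :: s1)).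
- by rewrite -(perm_cons y) -(permPr st) perm_sym -cat1s perm_catCA.
elim/last_ind: p1 p2 Ps {st} => [|p1 a IHp] p2 //.
by rewrite !cat_rcons => /H /IHp.
Qed.

Lemma reach_content lam csh u s t : component_inv lam csh u -> perm_eq s t ->
  has_content s u -> exists2 v, reach lam csh u v & has_content t v.
Proof.
move=> Hu st Hs.
apply: (@perm_swap_ind (fun s => exists2 v, reach lam csh u v & has_content s v) _ s) => //.
  move=> s1 x y s2 [v rv /reach_swap]; case: (rv) => _ Hv /(_ _ _ Hv) [w rw Hw].
  by exists w => //; apply: reach_trans rw.
by exists u => //; split=> //; apply: rst_refl.
Qed.

(** * Inversions of adjacent letters and the quasi-ribbon shape *)

Lemma subseq2_cons (a b x : nat) v :
  subseq [:: b; a] (x :: v) = if b == x then a \in v else subseq [:: b; a] v.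
Proof. by rewrite /= -sub1seq eq_sym; case: eqP. Qed.

Lemma minus_no_subseq i v : ~~ subseq [:: i.+1; i] v -> minus i v = count_mem i.+1 v.
Proof.
elim: v => [|x v IH] //; rewrite subseq2_cons /= (eq_sym x).
case: eqP => [_ h|_ /IH -> //]; rewrite plus_notin // IH; first by move=> /=; lia.
by apply: contra h => /mem_subseq; apply; rewrite !inE eqxx orbT.
Qed.

Lemma adjacent_inversion lam csh alpha v i :
  (forall k, sumn (map (minn k) csh) = sumn (take k lam)) ->
  component_inv lam csh v -> perm_eq lam alpha -> is_composition alpha ->
  has_content alpha v -> 0 < i < size alpha -> subseq [:: i.+1; i] v.
Proof.
move=> Hc Hv Hp Ha Hcont /andP[i0 im]; apply/negPn/negP => /minus_no_subseq Hm.
(* By [Hm] every i+1 is unmatched, so all of them can become i; the letters of [w] then lie in the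
   set [S] below, one smaller than the number of parts. *)
have [w [[_ Hw] e1 e2 e3]] := raise_string i0 Hv (leqnn _).
have w0 : count_mem i.+1 w = 0 by lia.
pose S := rem i.+1 (iota 1 (size alpha)).
have SS : size S = (size alpha).-1.
  by rewrite size_rem ?size_iota // mem_iota; lia.
have Sw : count (mem S) w = size w.
  apply/eqP; rewrite -all_count; apply/allP => x xw /=.
  rewrite mem_rem_uniq ?iota_uniq // inE mem_iota; apply/andP.
  have x0 : 0 < x by case: Hw => /allP hw _ _; apply: hw.
  have cx : 0 < count_mem x w by rewrite -has_count has_pred1.
  have ni : x != i.+1 by apply/eqP => E; rewrite E w0 in cx.
  split=> //; case: (x =P i) => [-> |/eqP nx]; first by lia.
  rewrite e3 // in cx; case: x x0 cx {xw ni nx} => // x _; rewrite Hcont => cx.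
  have : x < size alpha by rewrite ltnNge; apply: contraTN cx => h; rewrite nth_default.
  by lia.
have sw : size w = sumn lam.
  case: Hw => _ [R [_ sR /knuth_perm /perm_size ->]] _.
  by rewrite size_flatten /shape sR sumn_rev.
have sl : size lam = (size alpha).-1.+1 by rewrite (perm_size Hp); lia.
have := sumn_takeS lam (size alpha).-1; rewrite -sl take_size => E.
have n0 : 0 < nth 0 lam (size alpha).-1.
  have : all (fun k => 0 < k) lam by rewrite (perm_all _ Hp).
  by move=> /allP; apply; apply: mem_nth; rewrite sl.
(* The columns bound the size of [w] by the sum of all parts of [lam] but the last, which is
   positive. *)
case: Hw => _ _ /(count_columns_le S); rewrite Sw sw SS Hc E; lia.
Qed.

Lemma qr_aux_inversions u a n cur :
  (forall i, a <= i < a + n -> subseq [:: i.+1; i] u) ->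
  tab_shape (qr_aux u a (iota a.+1 n) cur) =
  size cur :: [seq count_mem b u | b <- iota a.+1 n].
Proof.
elim: n a cur => //= n IH a cur H; rewrite H; last by lia.
by rewrite /= -/(tab_shape _) IH ?size_nseq // => i Hi; apply: H; lia.
Qed.

Lemma qr_shape_content alpha v : is_word v -> is_composition alpha ->
  has_content alpha v ->
  (forall i, 0 < i < size alpha -> subseq [:: i.+1; i] v) -> qr_shape v = alpha.
Proof.
move=> Hw Ha Hc H.
have E : sort leq (undup v) = iota 1 (size alpha).
  apply: (sorted_eq leq_trans anti_leq).
  - exact: (sort_sorted leq_total).
  - exact: iota_sorted.
  rewrite perm_sort; apply: uniq_perm; rewrite ?undup_uniq ?iota_uniq // => x.
  rewrite mem_undup mem_iota -has_pred1 has_count; case: x => [|x].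
    by rewrite (count_memPn _) //; apply/negP => /(allP Hw).
  rewrite Hc; case: (ltnP x (size alpha)) => hx.
    by rewrite (allP Ha) ?mem_nth //; lia.
  by rewrite nth_default //; lia.
rewrite /qr_shape /qr_tableau E.
have Es : alpha = [seq count_mem b v | b <- iota 1 (size alpha)].
  apply: (@eq_from_nth _ 0); first by rewrite size_map size_iota.
  by move=> j hj; rewrite (nth_map 0) ?size_iota // nth_iota // Hc.
case Em: (size alpha) => [|m] /=; first by case: (alpha) Em.
rewrite qr_aux_inversions => [|i Hi]; last by apply: H; lia.
by rewrite size_nseq [RHS]Es Em.
Qed.

(** * Inverse standardisation and quasi-Kashiwara arrows *)

Fixpoint positions (n a : nat) (u : seq nat) : seq nat :=
  if u is x :: u' then
    if x == a then n :: positions n.+1 a u' else positions n.+1 a u'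
  else [::].

Lemma positions_cat n a u v :
  positions n a (u ++ v) = positions n a u ++ positions (n + size u) a v.
Proof.
by elim: u n => [|x u IH] n /=; rewrite ?addn0 // IH addSnnS; case: eqP.
Qed.

Lemma positions_notin n a u : a \notin u -> positions n a u = [::].
Proof.
elim: u n => //= x u IH n; rewrite inE negb_or eq_sym => /andP[/negPf -> /IH]; exact.
Qed.

Lemma size_positions n a u : size (positions n a u) = count_mem a u.
Proof. by elim: u n => //= x u IH n; case: eqP => /=; rewrite IH. Qed.

Lemma positions_ge n a u : all (leq n) (positions n a u).
Proof.
elim: u n => //= x u IH n.
have H : all (leq n) (positions n.+1 a u) by apply: sub_all (IH n.+1) => y; lia.
by case: eqP => //=; rewrite leqnn.
Qed.

Lemma positions_sorted n a u : sorted leq (positions n a u).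
Proof.
elim: u n => //= x u IH n; case: eqP => //= _; rewrite (path_sortedE leq_trans) IH andbT.
by apply: sub_all (positions_ge n.+1 a u) => y; lia.
Qed.

(** It suffices to compare the first b, at [q], with the last a. Row breaks in [qr_aux] thus become
    descents between consecutive position lists. *)
Lemma subseq2_positions n a b q r u : a != b -> a \in u ->
  positions n b u = q :: r ->
  subseq [:: b; a] u = (q < last 0 (positions n a u)).
Proof.
move=> ab; elim: u n => // x u IH n au; rewrite subseq2_cons.
have lastge m : a \in u -> m <= last 0 (positions m a u).
  move=> h; have := positions_ge m a u; have := size_positions m a u.
  case: (positions m a u) => [|y s].
    by move=> /esym/eqP; rewrite -leqn0 leqNgt -has_count has_pred1 h.
  by move=> _ /allP; apply; rewrite /= mem_last.
rewrite /= (eq_sym x b); case: (b =P x) => [E [<- _]|bx Eq].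
  have au' : a \in u by move: au; rewrite inE -E (negPf ab).
  by rewrite -E eq_sym (negPf ab) au' lastge.
have hq : n < q by have := positions_ge n.+1 b u; rewrite Eq /= => /andP[].
case: (boolP (a \in u)) => au'.
  rewrite (IH n.+1) //; case: (x == a) => //=.
  have := size_positions n.+1 a u; case: (positions n.+1 a u) => //=.
  by move/esym/eqP; rewrite -leqn0 leqNgt -has_count has_pred1 au'.
rewrite (positions_notin _ au'); have -> : subseq [:: b; a] u = false.
  by apply/negP => /mem_subseq /(_ a); rewrite !inE eqxx orbT (negPf au') => /(_ isT).
by case: eqP => _ /=; lia.
Qed.

(** Lengths of the maximal weakly ascending runs; [c] is the length so far of the run ending at
    [prev]. *)
Fixpoint runs (prev c : nat) (l : seq nat) : seq nat :=
  if l is x :: l' then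
    if x < prev then c :: runs x 1 l' else runs x c.+1 l'
  else [:: c].

Lemma runs_cat q c r l : path leq q r ->
  runs q c (r ++ l) = runs (last q r) (c + size r) l.
Proof.
elim: r q c => [|x r IH] q c /=; first by rewrite addn0.
by move=> /andP[qx Hr]; rewrite ltnNge qx /= IH // addSnnS.
Qed.

Lemma qr_aux_runs u prev l cur : prev \in u -> all (mem u) l -> uniq (prev :: l) ->
  tab_shape (qr_aux u prev l cur) =
  runs (last 0 (positions 0 prev u)) (size cur)
       (flatten [seq positions 0 a u | a <- l]).
Proof.
elim: l prev cur => //= a l IH prev cur pu /andP[au lu] /andP[pl ul].
have pa : prev != a by move: pl; rewrite inE negb_or => /andP[].
have := size_positions 0 a u; have := positions_sorted 0 a u.
have := @subseq2_positions 0 prev a _ _ u pa pu.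
case E: (positions 0 a u) => [|q r] /=.
  by move=> _ _ /esym/eqP; rewrite -leqn0 leqNgt -has_count has_pred1 au.
move=> /(_ _ _ erefl) -> Hs Hn; case: ltnP => Hq /=.
  by rewrite -/(tab_shape _) IH // size_nseq E /= -Hn runs_cat // add1n.
by rewrite IH // size_cat size_nseq E /= -Hn runs_cat // addSnnS.
Qed.

(* The positions of [u], sorted by letter and then by position, form the inverse
   of the standardisation of [u]; its ascending runs are the rows. *)
Definition inverse_std (N : nat) (u : seq nat) : seq nat :=
  flatten [seq positions 0 a u | a <- iota 0 N].

(** Absent letters have empty position lists, so all letters below [N] may be listed; a common [N]
    makes two words comparable. *)
Lemma qr_shape_runs N u : all (fun x => x < N) u ->
  qr_shape u = if inverse_std N u is x :: l then runs x 1 l else [::].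
Proof.
move=> uN; pose L := [seq a <- iota 0 N | a \in u].
have E : sort leq (undup u) = L.
  apply: (sorted_eq leq_trans anti_leq).
  - exact: (sort_sorted leq_total).
  - by apply: sorted_filter; [exact: leq_trans | exact: iota_sorted].
  rewrite perm_sort; apply: uniq_perm; rewrite ?undup_uniq ?filter_uniq ?iota_uniq // => x.
  rewrite mem_undup mem_filter mem_iota; case: (boolP (x \in u)) => //= xu.
  by rewrite (allP uN).
have -> : inverse_std N u = flatten [seq positions 0 a u | a <- L].
  rewrite /inverse_std /L; elim: (iota 0 N) => //= a s ->.
  by case: (boolP (a \in u)) => //= /positions_notin ->.
have Lu : all (mem u) L by apply/allP => x; rewrite mem_filter => /andP[].
have Lun : uniq L by rewrite filter_uniq ?iota_uniq.
rewrite /qr_shape /qr_tableau E; case: L Lu Lun {E} => //= a l /andP[au lu] ul.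
rewrite qr_aux_runs // size_nseq.
have := size_positions 0 a u; have := positions_sorted 0 a u.
case: (positions 0 a u) => [|q r] /=.
  by move=> _ /esym/eqP; rewrite -leqn0 leqNgt -has_count has_pred1 au.
by move=> Hs <-; rewrite runs_cat // add1n.
Qed.

(** The changed position moves from the end of the list of i to the start of the adjacent list of
    i+1, which leaves the concatenation unchanged. *)
Lemma inverse_std_hypo N i p q : i.+1 < N -> i.+1 \notin p -> i \notin q ->
  inverse_std N (p ++ i :: q) = inverse_std N (p ++ i.+1 :: q).
Proof.
move=> iN ip iq; rewrite /inverse_std.
have -> : iota 0 N = iota 0 i ++ [:: i, i.+1 & iota i.+2 (N - i.+2)].
  by rewrite -[RHS](iotaD 0 i (N - i.+2).+2); congr iota; lia.
rewrite !map_cat !flatten_cat /=.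
have H a : a != i -> a != i.+1 ->
    positions 0 a (p ++ i :: q) = positions 0 a (p ++ i.+1 :: q).
  by move=> h1 h2; rewrite !positions_cat /= eq_sym (negPf h1) eq_sym (negPf h2).
congr (flatten _ ++ _).
  by apply/eq_in_map => a; rewrite mem_iota => ha; apply: H; lia.
rewrite !positions_cat /= !eqxx (positions_notin _ ip) (positions_notin _ iq) /=.
have -> : (i == i.+1) = false by lia.
have -> : (i.+1 == i) = false by lia.
rewrite cats0 -catA /=; congr (_ ++ _ :: _ ++ flatten _).
by apply/eq_in_map => a; rewrite mem_iota => ha; apply: H; lia.
Qed.

Lemma hypo_f_split i u w : hypo_f i u = Some w -> exists p q,
  [/\ u = p ++ i :: q, w = p ++ i.+1 :: q, i.+1 \notin p & i \notin q].
Proof.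
rewrite /hypo_f; case: ifP => // /andP[iu ns] [<-].
have [p [q [E iq]]] : exists p q, u = p ++ i :: q /\ i \notin q.
  elim: u iu {ns} => // x u IH; rewrite inE; case: (boolP (i \in u)) => [h _|h].
    by have [p [q [-> hq]]] := IH h; exists (x :: p), q.
  by rewrite orbF => /eqP <-; exists [::], u.
exists p, q; split=> //; last first.
  apply: contra ns => hp; rewrite E -(cat1s i.+1 [:: i]).
  by apply: cat_subseq; rewrite sub1seq // mem_head.
rewrite E rev_cat rev_cons cat_rcons index_cat mem_rev (negPf iq) /= eqxx addn0.
rewrite size_rev size_cat /= addnS /= addnK; exact: set_nth_cat.
Qed.

Lemma hypo_conn_plac v w : hypo_conn v w -> plac_conn v w /\ qr_shape v = qr_shape w.
Proof.
elim=> [x y [i [i0 /hypo_f_split [p [q [Ex Ey ip iq]]]]]|x|x y _ [c ->]|x y z _ [c1 ->] _ [c2 ->]].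
- split.
    apply: rst_step; exists i; split=> //; apply: arrow_kash; exists p, q; split=> //.
      exact: minus_notin.
    exact: plus_notin.
  (* A bound above the letters of both words: each letter of [y] is at most [sumn y]. *)
  pose N := (i.+1 + sumn y).+1.
  have yN : all (fun a => a < N) y.
    have : all (fun a => a <= sumn y) y.
      by elim: (y) => //= a s IH; rewrite leq_addr; apply: sub_all IH => b; lia.
    by apply: sub_all => a; rewrite /N; lia.
  have xN : all (fun a => a < N) x.
    by move: yN; rewrite Ex Ey !all_cat /= => /and3P[-> _ ->]; rewrite andbT /N; lia.
  by rewrite (qr_shape_runs xN) (qr_shape_runs yN) Ex Ey inverse_std_hypo // /N; lia.
- by split=> //; apply: rst_refl.
- by split=> //; apply: rst_sym.
by split=> //; apply: rst_trans c1 c2.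
Qed.

Theorem theorem6p2 (alpha : seq nat) :
  is_composition alpha ->
  forall u : seq nat, is_word u ->
    tab_shape (schensted_P u) = sort geq alpha ->
    exists v : seq nat, plac_conn u v /\
      (forall w : seq nat, hypo_conn v w -> plac_conn u w /\ qr_shape w = alpha).
Proof.
move=> Ha u Hu; set lam := sort geq alpha => Hlam.
have [T K] := schensted_knuth u; have [C [HC KC Hcol]] := row_word_columns T.
rewrite /tab_shape in Hlam; rewrite Hlam in Hcol.
have inv : component_inv lam (map size C) u.
  split=> //.
    exists (rev (schensted_P u)); split=> //; last by rewrite map_rev Hlam.
    by rewrite all_rev; case/andP: T.
  by exists C; split=> //; apply: knuth_trans K KC.
have [h [uh invh] Hh] := reach_highest inv.
have Hp : perm_eq lam alpha by rewrite perm_sort.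
have [v [hv invv] Hv] := reach_content invh Hp (highest_weight_content Hcol invh Hh).
have uv : plac_conn u v by apply: rst_trans uh hv.
exists v; split=> // w /hypo_conn_plac [vw <-]; split; first by apply: rst_trans uv vw.
apply: qr_shape_content => //; first by case: invv.
by move=> i; apply: adjacent_inversion Hcol invv Hp Ha Hv.
Qed.
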